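(* Let $(X,d)$ be a cone metric space, let $r\in E$ with $0\ll r$ or $r=0$, and let $x\in X$. Let $\{x_n\}$ and $\{y_n\}$ be two sequences in $X$ such that for every $\epsilon\in E$ with $0\ll\epsilon$ there exists $k\in\mathbb{N}$ such that $d(x_n,y_n)\le\epsilon$ for all $n\ge k$. Then $\{x_n\}$ is $r$-convergent to $x$ if and only if $\{y_n\}$ is $r$-convergent to $x$.
   Context: Let $E$ be a real Banach space. A subset $P\subset E$ is a cone if (i) $P$ is closed, nonempty and $P\neq\{0\}$; (ii) $a,b\in\mathbb{R}$, $a,b\ge 0$, $x,y\in P$ implies $ax+by\in P$; (iii) $x\in P$ and $-x\in P$ implies $x=0$. Write $x\le y$ if $y-x\in P$, $x<y$ if $x\le y$ and $x\ne y$, and $x\ll y$ if $y-x\in \mathrm{int}\,P$ (the interior of $P$). A cone metric space $(X,d)$ (associated with $E$ and $P$) is a nonempty set $X$ with a map $d:X\times X\to E$ such that for all $x,y,z\in X$: $0\le d(x,y)$, and $d(x,y)=0$ iff $x=y$; $d(x,y)=d(y,x)$; $d(x,y)\le d(x,z)+d(z,y)$. For $r\in E$ with $0\ll r$ or $r=0$, a sequence $\{x_n\}$ in $X$ is $r$-convergent to $x\in X$ if for every $\epsilon\in E$ with $0\ll\epsilon$ there is $k\in\mathbb{N}$ such that $d(x_n,x)\ll r+\epsilon$ for all $n\ge k$. *)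

(* Defs.v *)
From mathcomp Require Import all_boot all_order all_algebra.
From mathcomp Require Import all_classical all_reals all_analysis.

Set Implicit Arguments.
Unset Strict Implicit.
Unset Printing Implicit Defensive.

Import Order.TTheory GRing.Theory Num.Theory.
Import numFieldNormedType.Exports.

Local Open Scope classical_set_scope.
Local Open Scope ring_scope.

Section ConeMetric.
Context {R : realType} {E : completeNormedModType R}.
Implicit Types (P : set E) (r u v : E).

Record is_cone P : Prop := IsCone {
  cone_closed : closed P;
  cone_nonempty : P !=set0;
  cone_neq0 : P <> [set 0];
  cone_comb : forall (a b : R) u v,
    0 <= a -> 0 <= b -> P u -> P v -> P (a *: u + b *: v);
  cone_pointed : forall u, P u -> P (- u) -> u = 0
}.

Definition cone_le P u v : Prop := P (v - u).

(* u << v; the interior of P is not assumed to be nonempty. *)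
Definition cone_ll P u v : Prop := interior P (v - u).

Record is_cone_metric P (X : Type) (d : X -> X -> E) : Prop := IsConeMetric {
  cone_metric_nonempty : [set: X] !=set0;
  cone_metric_ge0 : forall x y, cone_le P 0 (d x y);
  cone_metric_eq0 : forall x y, d x y = 0 <-> x = y;
  cone_metric_sym : forall x y, d x y = d y x;
  cone_metric_triangle : forall x y z,
    cone_le P (d x y) (d x z + d z y)
}.

(* Meant for r = 0 or 0 << r; this condition on r is not part of the
   definition. *)
Definition r_convergent P (X : Type) (d : X -> X -> E) r
    (x_ : nat -> X) (x : X) : Prop :=
  forall eps : E, cone_ll P 0 eps ->
    exists k : nat, forall n : nat, (k <= n)%N ->
      cone_ll P (d (x_ n) x) (r + eps).

End ConeMetric.

(* Main.v *)
Require Import Defs.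
From mathcomp Require Import all_boot all_order all_algebra.
From mathcomp Require Import all_classical all_reals all_analysis.

Import Order.TTheory GRing.Theory Num.Theory.
Import numFieldNormedType.Exports.

Local Open Scope ring_scope.

(** Split [eps] into two halves: the triangle inequality through [x_ n] gives
    [d (y_ n) x <= d (x_ n) (y_ n) + d (x_ n) x], where the first term is
    eventually [<= eps / 2] and the second eventually [<< r + eps / 2]. This
    suffices because [int P + P] is contained in [int P]. The hypotheses are
    symmetric in the two sequences. *)

Section Cone.
Context {R : realType} {E : completeNormedModType R} {P : set E}.
Hypothesis hP : is_cone P.

Lemma coneD (u v : E) : P u -> P v -> P (u + v).
Proof. by move=> Pu Pv; rewrite -[u]scale1r -[v]scale1r; apply: cone_comb. Qed.

Lemma coneZ (a : R) (u : E) : 0 <= a -> P u -> P (a *: u).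
Proof.
move=> a0 Pu; rewrite -[_ *: _]addr0 -[X in _ + X](scale0r u).
exact: cone_comb.
Qed.

(** Translation by [- v] is continuous and sends [u + v] to [u], so [z - v] stays in [P] for [z]
    near [u + v]; adding [v] back keeps [z] in [P]. *)
Lemma interior_coneD (u v : E) : interior P u -> P v -> interior P (u + v).
Proof.
move=> Pu Pv.
have cvg_sub : continuous (fun z : E => z - v).
  by move=> z; apply: cvgB; [exact: cvg_id|exact: cvg_cst].
have : nbhs (u + v - v) P by rewrite addrK.
move=> /(cvg_sub (u + v)) near_uv.
rewrite /interior /=; near=> z.
have Pzv : P (z - v) by near: z.
by rewrite -(subrK v z); apply: coneD.
Unshelve. all: by end_near. Qed.

(** Same pull-back argument, now along the continuous map [z |-> a^-1 *: z]. *)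
Lemma interior_coneZ (a : R) (u : E) :
  0 < a -> interior P u -> interior P (a *: u).
Proof.
move=> a0 Pu.
have : nbhs (a^-1 *: (a *: u)) P by rewrite scalerK ?gt_eqF.
move=> /(@scaler_continuous _ _ a^-1 (a *: u)) near_au.
rewrite /interior /=; near=> z.
have Paz : P (a^-1 *: z) by near: z.
by rewrite -[z](scalerKV (lt0r_neq0 a0)); apply: coneZ => //; apply: ltW.
Unshelve. all: by end_near. Qed.

(** One implication, with the sequences as parameters so that it also serves with [x_] and [y_]
    exchanged. *)
Lemma r_convergent_close (X : Type) (d : X -> X -> E) (r : E) (x : X)
    (x_ y_ : nat -> X) :
  is_cone_metric P d ->
  (forall eps : E, cone_ll P 0 eps ->
    exists k : nat, forall n : nat, (k <= n)%N ->
      cone_le P (d (x_ n) (y_ n)) eps) ->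
  r_convergent P d r x_ x -> r_convergent P d r y_ x.
Proof.
move=> hd hxy cx eps eps0; pose e := 2^-1 *: eps.
have e0 : cone_ll P 0 e.
  by move: eps0; rewrite /cone_ll !subr0; apply: interior_coneZ.
have eps_half : eps = e + e by rewrite /e -scalerDl -[2^-1]mul1r -splitr scale1r.
have [k1 close] := hxy e e0; have [k2 near_x] := cx e e0.
exists (maxn k1 k2) => n; rewrite geq_max => /andP[k1n k2n].
have tri := cone_metric_triangle hd (y_ n) x (x_ n).
have sum := interior_coneD _ _ (near_x n k2n) (coneD _ _ (close n k1n) tri).
(* Turns [d (y_ n) (x_ n)] into [d (x_ n) (y_ n)], which cancels against the term from [close]. *)
rewrite (cone_metric_sym hd (y_ n)) in sum.
rewrite /cone_ll eps_half; congr (interior P _): sum.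
(* The sum telescopes to [r + (e + e) - d (y_ n) x]. *)
by rewrite (addrA (e - _)) subrKA (addrC e) (addrA (r + e - _)) subrKA -(addrA r).
Qed.

End Cone.

Theorem theorem3p8 (R : realType) (E : completeNormedModType R) (P : set E)
    (X : Type) (d : X -> X -> E) (r : E) (x : X) (x_ y_ : nat -> X)
    (hP : is_cone P) (hd : is_cone_metric P d)
    (hr : cone_ll P 0 r \/ r = 0)
    (hxy : forall eps : E, cone_ll P 0 eps ->
      exists k : nat, forall n : nat, (k <= n)%N ->
        cone_le P (d (x_ n) (y_ n)) eps) :
  r_convergent P d r x_ x <-> r_convergent P d r y_ x.
Proof.
(* What remains is the closeness hypothesis of the converse, with the sequences exchanged. *)
split; apply: r_convergent_close => // eps /hxy[k close].
by exists k => n /close; rewrite (cone_metric_sym hd).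
Qed.
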